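(* Let $(A,\prec_A,\succ_A,P)$ be a Rota-Baxter dendriform algebra of weight $\lambda$. Then $(A^*,-\lambda\mathrm{Id}-P^*,\mathcal{R}_A^*,-L_{\prec_A}^*,-R_{\succ_A}^*,\mathcal{L}_A^* )$ is a representation of $(A,\prec_A,\succ_A,P)$ (called the coregular representation). Moreover, if $(A,\prec_A,\succ_A,P,\omega)$ is a quadratic Rota-Baxter dendriform algebra of weight $\lambda$, then the linear map $\omega^\sharp:A\to A^*$ defined by $\langle\omega^\sharp(x),y\rangle=\omega(x,y)$ is an isomorphism from the regular representation $(A,P,L_{\succ_A},R_{\succ_A},L_{\prec_A},R_{\prec_A})$ to the coregular representation $(A^*,-\lambda\mathrm{Id}-P^*,\mathcal{R}_A^*,-L_{\prec_A}^*,-R_{\succ_A}^*,\mathcal{L}_A^* )$.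
   Context: All vector spaces are finite-dimensional over a field $\mathbb{K}$; $\lambda\in\mathbb{K}$. A dendriform algebra $(A,\prec_A,\succ_A)$ is a vector space with two bilinear products such that, with $x\ast y=x\prec_A y+x\succ_A y$, for all $x,y,z$: $(x\prec_A y)\prec_A z=x\prec_A(y\ast z)$, $(x\succ_A y)\prec_A z=x\succ_A(y\prec_A z)$, $x\succ_A(y\succ_A z)=(x\ast y)\succ_A z$. Put $L_{\succ_A}(x)y=x\succ_A y$, $L_{\prec_A}(x)y=x\prec_A y$, $R_{\succ_A}(x)y=y\succ_A x$, $R_{\prec_A}(x)y=y\prec_A x$, $\mathcal{L}_A=L_{\prec_A}+L_{\succ_A}$, $\mathcal{R}_A=R_{\prec_A}+R_{\succ_A}$. For $F:A\to\mathfrak{gl}(A)$ define $F^*:A\to\mathfrak{gl}(A^* )$ by $\langle F^*(x)\xi,y\rangle=\langle\xi,F(x)y\rangle$ (no sign); $P^*:A^*\to A^*$ is the transpose of $P$. A Rota-Baxter operator of weight $\lambda$ on $(A,\prec_A,\succ_A)$ is a linear map $P:A\to A$ with $P(x)\prec_A P(y)=P(P(x)\prec_A y+x\prec_A P(y)+\lambda x\prec_A y)$ and $P(x)\succ_A P(y)=P(P(x)\succ_A y+x\succ_A P(y)+\lambda x\succ_A y)$; then $(A,\prec_A,\succ_A,P)$ is a Rota-Baxter dendriform algebra of weight $\lambda$. A quadratic Rota-Baxter dendriform algebra of weight $\lambda$ is $(A,\prec_A,\succ_A,P,\omega)$ with $(A,\prec_A,\succ_A,P)$ a Rota-Baxter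 dendriform algebra of weight $\lambda$ and $\omega\in\wedge^2A^*$ a nondegenerate skew-symmetric bilinear form with $\omega(x\succ_A y,z)=-\omega(x,y\prec_A z)=\omega(y,z\ast x)$ and $\omega(Px,y)+\omega(x,Py)+\lambda\omega(x,y)=0$ for all $x,y,z\in A$. Linear maps $l_\succ,r_\succ,l_\prec,r_\prec:A\to\mathfrak{gl}(V)$ form a representation of the dendriform algebra $(A,\prec_A,\succ_A)$ on $V$ if $A\oplus V$ with $(x+u)\succ(y+v)=x\succ_A y+l_\succ(x)v+r_\succ(y)u$ and $(x+u)\prec(y+v)=x\prec_A y+l_\prec(x)v+r_\prec(y)u$ is a dendriform algebra. A representation $(V,T,l_\succ,r_\succ,l_\prec,r_\prec)$ of the Rota-Baxter dendriform algebra $(A,\prec_A,\succ_A,P)$ of weight $\lambda$ consists of such a representation and $T\in\mathfrak{gl}(V)$ such that for each $m\in\{l_\succ,r_\succ,l_\prec,r_\prec\}$ and all $x\in A,u\in V$: $m(Px)(Tu)=T\big(m(Px)u+m(x)(Tu)+\lambda m(x)u\big)$. The regular representation is $(A,P,L_{\succ_A},R_{\succ_A},L_{\prec_A},R_{\prec_A})$. A homomorphism from $(V,T,l_\succ,r_\succ,l_\prec,r_\prec)$ to $(V',T',l'_\succ,r'_\succ,l'_\prec,r'_\prec)$ is a linear map $\phi:V\to V'$ with $\phi\circ T=T'\circ\phi$ and $\phi\circ l_\succ(x)=l'_\succ(x)\circ\phi$, $\phi\circ r_\succ(x)=r'_\succ(x)\circ\phi$, $\phi\circ l_\prec(x)=l'_\prec(x)\circ\phi$,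 $\phi\circ r_\prec(x)=r'_\prec(x)\circ\phi$ for all $x\in A$; an isomorphism is a bijective homomorphism. *)

(* Defs.v *)
From HB Require Import structures.
From mathcomp Require Import all_boot all_order all_algebra.

Set Implicit Arguments.
Unset Strict Implicit.
Unset Printing Implicit Defensive.

Import GRing.Theory.
Local Open Scope ring_scope.

(** Conventions: [gl(V)] is ['End(V)], the dual [A^*] is ['Hom(A, K^o)], and a
    linear map [A -> gl(V)] is an element of ['Hom(A, 'End(V))].  Since
    [linfun f] agrees with [f] only when [f] is linear, each definition through
    [linfun] comes with an evaluation lemma. *)

Lemma linfun_linearE (K : fieldType) (V W : vectType K)
    (f : V -> W) :
  linear f -> linfun f =1 f.
Proof.
move=> f_lin.
pose fM := GRing.isLinear.Build K V W *:%R f f_lin.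
pose fL : {linear V -> W} := HB.pack f fM.
exact: (lfunE fL).
Qed.

Section Curry.
Variables (K : fieldType) (U V W : vectType K).

(** The linear map [x |-> f x] into ['Hom(V, W)] of a bilinear [f]. *)
Definition curry (f : U -> V -> W) : 'Hom(U, 'Hom(V, W)) :=
  linfun (fun x => linfun (f x)).

Lemma curryE (f : U -> V -> W) :
  bilinear_for *:%R *:%R f -> forall x y, curry f x y = f x y.
Proof.
case=> fl fr x y; rewrite /curry linfun_linearE ?linfun_linearE // => a u v.
by apply/lfunP => z; rewrite add_lfunE scale_lfunE !linfun_linearE // fl.
Qed.

End Curry.

Section Mult.
Variables (K : fieldType) (A : vectType K).
Implicit Type m : {bilinear A -> A -> A}.

Definition lmult m : 'Hom(A, 'End(A)) := curry m.
Definition rmult m : 'Hom(A, 'End(A)) := curry (fun x y => m y x).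

Lemma lmultE m x y : lmult m x y = m x y.
Proof.
by rewrite /lmult curryE //; split=> u a v w; rewrite ?linearPl ?linearPr.
Qed.

Lemma rmultE m x y : rmult m x y = m y x.
Proof.
by rewrite /rmult curryE //; split=> u a v w; rewrite ?linearPl ?linearPr.
Qed.

End Mult.

Section Dual.
Variables (K : fieldType).

Definition transpose (V W : vectType K) (f : 'Hom(V, W)) :
    'Hom('Hom(W, K^o), 'Hom(V, K^o)) :=
  linfun (fun xi : 'Hom(W, K^o) => (xi \o f)%VF).

Lemma transposeE (V W : vectType K) (f : 'Hom(V, W)) (xi : 'Hom(W, K^o)) v :
  transpose f xi v = xi (f v).
Proof.
rewrite /transpose linfun_linearE ?comp_lfunE // => a u w.
by rewrite comp_lfunDl comp_lfunZl.
Qed.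

(** [F^*], with [<F^*(x) xi, y> = <xi, F(x) y>] (no sign). *)
Definition dual_act (A V : vectType K) (F : 'Hom(A, 'End(V))) :
    'Hom(A, 'End('Hom(V, K^o))) :=
  linfun (fun x => transpose (F x)).

Lemma dual_actE (A V : vectType K) (F : 'Hom(A, 'End(V))) x
    (xi : 'Hom(V, K^o)) v :
  dual_act F x xi v = xi (F x v).
Proof.
rewrite /dual_act linfun_linearE ?transposeE // => a y z; apply/lfunP => eta.
apply/lfunP => w; rewrite !(add_lfunE, scale_lfunE) !transposeE linearP.
by rewrite !(add_lfunE, scale_lfunE) linearP.
Qed.

End Dual.

Section Dendriform.
Variable K : fieldType.

Definition dendriform_mult (A : vectType K)
    (prec succ : {bilinear A -> A -> A}) (x y : A) : A :=
  prec x y + succ x y.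

Record is_dendriform (A : vectType K)
    (prec succ : {bilinear A -> A -> A}) : Prop := IsDendriform {
  dendriform_prec_prec : forall x y z,
    prec (prec x y) z = prec x (dendriform_mult prec succ y z);
  dendriform_succ_prec : forall x y z,
    prec (succ x y) z = succ x (prec y z);
  dendriform_succ_succ : forall x y z,
    succ x (succ y z) = succ (dendriform_mult prec succ x y) z
}.

Definition is_rota_baxter (lambda : K) (A : vectType K)
    (m : {bilinear A -> A -> A}) (P : 'End(A)) : Prop :=
  forall x y, m (P x) (P y) = P (m (P x) y + m x (P y) + lambda *: m x y).

Record is_rb_dendriform (lambda : K) (A : vectType K)
    (prec succ : {bilinear A -> A -> A}) (P : 'End(A)) : Prop :=
  IsRBDendriform {
  rb_dendriform : is_dendriform prec succ;
  rb_prec : is_rota_baxter lambda prec P;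
  rb_succ : is_rota_baxter lambda succ P
}.

Record is_quadratic_rb_dendriform (lambda : K) (A : vectType K)
    (prec succ : {bilinear A -> A -> A}) (P : 'End(A))
    (omega : {skew_symmetric A}) : Prop := IsQuadraticRBDendriform {
  quadratic_rb : is_rb_dendriform lambda prec succ P;
  quadratic_nondegenerate : nondegenerate omega;
  quadratic_succ_prec : forall x y z,
    omega (succ x y) z = - omega x (prec y z);
  quadratic_succ_mult : forall x y z,
    omega (succ x y) z = omega y (dendriform_mult prec succ z x);
  quadratic_operator : forall x y,
    omega (P x) y + omega x (P y) + lambda * omega x y = 0
}.

End Dendriform.

Section SemiDirect.
Variables (K : fieldType) (A V : vectType K).
Variables (m : {bilinear A -> A -> A}) (l r : 'Hom(A, 'End(V))).

Definition semidirect (p q : A * V) : A * V :=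
  (m p.1 q.1, l p.1 q.2 + r q.1 p.2).

Lemma semidirect_bilinear : bilinear_for *:%R *:%R semidirect.
Proof.
split=> [[y v]|[x u]] a [x1 u1] [x2 u2]; congr (_, _) => /=.
- by rewrite linearPl.
- by rewrite !linearP !(add_lfunE, scale_lfunE) scalerDr addrACA.
- by rewrite linearPr.
- by rewrite !linearP !(add_lfunE, scale_lfunE) scalerDr addrACA.
Qed.

HB.instance Definition _ :=
  bilinear_isBilinear.Build K (A * V)%type (A * V)%type (A * V)%type
    *:%R *:%R semidirect semidirect_bilinear.

End SemiDirect.

Section Representations.
Variables (K : fieldType) (lambda : K) (A : vectType K).
Variables (prec succ : {bilinear A -> A -> A}) (P : 'End(A)).

(** The data [(V, T, l_succ, r_succ, l_prec, r_prec)], without the axioms. *)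
Record rep_data (V : vectType K) := RepData {
  rep_op : 'End(V);
  rep_lsucc : 'Hom(A, 'End(V));
  rep_rsucc : 'Hom(A, 'End(V));
  rep_lprec : 'Hom(A, 'End(V));
  rep_rprec : 'Hom(A, 'End(V))
}.

Definition is_dendriform_rep (V : vectType K)
    (lsucc rsucc lprec rprec : 'Hom(A, 'End(V))) : Prop :=
  is_dendriform (semidirect prec lprec rprec) (semidirect succ lsucc rsucc).

Definition rb_compatible (V : vectType K) (T : 'End(V))
    (m : 'Hom(A, 'End(V))) : Prop :=
  forall x u, m (P x) (T u) = T (m (P x) u + m x (T u) + lambda *: m x u).

Record is_rb_rep (V : vectType K) (rho : rep_data V) : Prop := IsRBRep {
  rb_rep_dendriform :
    is_dendriform_rep (rep_lsucc rho) (rep_rsucc rho)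
                      (rep_lprec rho) (rep_rprec rho);
  rb_rep_lsucc : rb_compatible (rep_op rho) (rep_lsucc rho);
  rb_rep_rsucc : rb_compatible (rep_op rho) (rep_rsucc rho);
  rb_rep_lprec : rb_compatible (rep_op rho) (rep_lprec rho);
  rb_rep_rprec : rb_compatible (rep_op rho) (rep_rprec rho)
}.

Record is_rb_rep_hom (V V' : vectType K) (rho : rep_data V)
    (rho' : rep_data V') (phi : 'Hom(V, V')) : Prop := IsRBRepHom {
  rb_hom_source : is_rb_rep rho;
  rb_hom_target : is_rb_rep rho';
  rb_hom_op : (phi \o rep_op rho = rep_op rho' \o phi)%VF;
  rb_hom_lsucc : forall x,
    (phi \o rep_lsucc rho x = rep_lsucc rho' x \o phi)%VF;
  rb_hom_rsucc : forall x,
    (phi \o rep_rsucc rho x = rep_rsucc rho' x \o phi)%VF;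
  rb_hom_lprec : forall x,
    (phi \o rep_lprec rho x = rep_lprec rho' x \o phi)%VF;
  rb_hom_rprec : forall x,
    (phi \o rep_rprec rho x = rep_rprec rho' x \o phi)%VF
}.

Definition is_rb_rep_iso (V V' : vectType K) (rho : rep_data V)
    (rho' : rep_data V') (phi : 'Hom(V, V')) : Prop :=
  is_rb_rep_hom rho rho' phi /\ bijective phi.

Definition regular_rep : rep_data A :=
  RepData P (lmult succ) (rmult succ) (lmult prec) (rmult prec).

Definition coregular_rep : rep_data 'Hom(A, K^o) :=
  RepData (- (lambda *: \1%VF) - transpose P)
    (dual_act (rmult prec + rmult succ))
    (- dual_act (lmult prec))
    (- dual_act (rmult succ))
    (dual_act (lmult prec + lmult succ)).

End Representations.

Section Sharp.
Variables (K : fieldType) (A : vectType K).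

Definition sharp (omega : {skew_symmetric A}) : 'Hom(A, 'Hom(A, K^o)) :=
  curry (omega : A -> A -> K^o).

Lemma sharpE (omega : {skew_symmetric A}) x y : sharp omega x y = omega x y.
Proof.
by rewrite /sharp curryE //; split=> u a v w; rewrite ?linearPl ?linearPr.
Qed.

End Sharp.

(* Main.v *)
(** Unfolding the semidirect product turns the representation axioms into nine
    identities between the four actions.  Paired with [xi] in the dual and [w]
    in [A], each of these for the coregular actions is [xi] applied to a
    consequence of the dendriform axioms.  An operator [F] compatible with [P]
    dualizes to an operator compatible with [- lambda - P^*]: in the weighted
    identity for [F^*] all terms cancel but [xi] of the identity for [F].  The
    invariance of [omega] says exactly that [omega^#] exchanges the two
    representations, and it is bijective because the form is nondegenerate and
    [dim A^* = dim A]. *)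

Require Import Defs.
From HB Require Import structures.
From mathcomp Require Import all_boot all_order all_algebra.
From mathcomp Require Import ring.

Set Implicit Arguments.
Unset Strict Implicit.
Unset Printing Implicit Defensive.
Import GRing.Theory.
Local Open Scope ring_scope.

Section Coregular.
Variables (K : fieldType) (A : vectType K).
Variables (prec succ : {bilinear A -> A -> A}).

Lemma coregular_opE (lambda : K) (P : 'End(A)) (xi : 'Hom(A, K^o)) y :
  (- (lambda *: \1%VF) - transpose P) xi y = - (lambda * xi y) - xi (P y).
Proof.
have := transposeE P xi y; move: (transpose P) => Q QE.
by rewrite !add_lfunE !opp_lfunE !scale_lfunE id_lfunE QE.
Qed.

Lemma rb_compatible_dual (lambda : K) (P : 'End(A)) (F : 'Hom(A, 'End(A))) :
    rb_compatible lambda P P F ->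
  rb_compatible lambda P (- (lambda *: \1%VF) - transpose P) (dual_act F).
Proof.
(* The dual operators are generalized to opaque variables: unification through
   [linfun] in their bodies is prohibitively slow. *)
move=> FP x xi; have DE := dual_actE F; have TE := coregular_opE lambda P.
move: (dual_act F) (_ - transpose P) DE TE => D T DE TE.
apply/lfunP => y.
rewrite DE !TE ![(_ + _ : 'Hom(A, K^o)) _]add_lfunE.
rewrite ![(_ *: _ : 'Hom(A, K^o)) _]scale_lfunE !DE !TE FP.
(* Scaling in [K^o] is multiplication in [K]; once displayed as such, the remaining scalar identity
   is accessible to [ring]. *)
rewrite !linearD !linearZ /= -![_ *: _]/(_ * _); ring.
Qed.

Lemma rb_compatible_opp (lambda : K) (P : 'End(A)) (V : vectType K)
    (T : 'End(V)) (F : 'Hom(A, 'End(V))) :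
  rb_compatible lambda P T F -> rb_compatible lambda P T (- F).
Proof.
move=> FP x u; rewrite !opp_lfunE FP -linearN; congr (T _).
by rewrite !opprD scalerN.
Qed.

(** The module component of each dendriform axiom is a sum of terms linear in one of [u], [v], [w].
    The hypotheses come in three triples, one per axiom, with the module element in the first,
    second and third position. *)
Lemma is_dendriform_rep_of (V : vectType K)
    (ls rs lp rp : 'Hom(A, 'End(V))) :
    is_dendriform prec succ ->
    (forall x y u, rp y (rp x u) = rp (prec x y) u + rp (succ x y) u) ->
    (forall x y u, rp y (lp x u) = lp x (rp y u) + lp x (rs y u)) ->
    (forall x y u, lp (prec x y) u = lp x (lp y u) + lp x (ls y u)) ->
    (forall x y u, rp y (rs x u) = rs (prec x y) u) ->
    (forall x y u, rp y (ls x u) = ls x (rp y u)) ->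
    (forall x y u, lp (succ x y) u = ls x (lp y u)) ->
    (forall x y u, rs (succ x y) u = rs y (rp x u) + rs y (rs x u)) ->
    (forall x y u, ls x (rs y u) = rs y (lp x u) + rs y (ls x u)) ->
    (forall x y u, ls x (ls y u) = ls (prec x y) u + ls (succ x y) u) ->
  is_dendriform_rep prec succ ls rs lp rp.
Proof.
case=> pp sp ss rpp rpl lpp rps rls lps rss lrs lls.
split=> -[x u] [y v] [z w]; congr (_, _) => //=; rewrite !linearD /=.
- by rewrite rpp rpl lpp add_lfunE addrA; congr (_ + _); rewrite addrACA.
- by rewrite rps rls lps addrA.
- by rewrite rss lrs lls add_lfunE -addrA; congr (_ + _); rewrite addrACA.
Qed.

Lemma dendriform_rep_coregular : is_dendriform prec succ ->
  is_dendriform_rep prec succ (dual_act (rmult prec + rmult succ))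
    (- dual_act (lmult prec)) (- dual_act (rmult succ))
    (dual_act (lmult prec + lmult succ)).
Proof.
move=> dA; have [pp sp ss] := dA; rewrite /dendriform_mult in pp ss.
have RE x xi w :
    dual_act (rmult prec + rmult succ) x xi w = xi (prec w x) + xi (succ w x).
  by rewrite dual_actE !add_lfunE !rmultE linearD.
have LE x xi w :
    dual_act (lmult prec + lmult succ) x xi w = xi (prec x w) + xi (succ x w).
  by rewrite dual_actE !add_lfunE !lmultE linearD.
have SE x xi w : (- dual_act (lmult prec)) x xi w = - xi (prec x w).
  by rewrite !opp_lfunE dual_actE lmultE.
have QE x xi w : (- dual_act (rmult succ)) x xi w = - xi (succ w x).
  by rewrite !opp_lfunE dual_actE rmultE.
move: (dual_act (_ + _)) (dual_act (_ + _)) (- dual_act _) (- dual_act _)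
  RE LE SE QE => R L S Q RE LE SE QE.
have DE (xi eta : 'Hom(A, K^o)) w : (xi + eta) w = xi w + eta w.
  exact: add_lfunE.
(* Used from left to right, [ppE], [sp] and [ssE] remove three of the eight three-letter words, so
   that both sides of an identity are compared on the five remaining ones. *)
have ppE (xi : 'Hom(A, K^o)) x y z :
    xi (prec (prec x y) z) = xi (prec x (prec y z)) + xi (prec x (succ y z)).
  by rewrite pp !linearD.
have ssE (xi : 'Hom(A, K^o)) x y z :
    xi (succ x (succ y z)) = xi (succ (prec x y) z) + xi (succ (succ x y) z).
  by rewrite ss linearDl linearD.
apply: is_dendriform_rep_of => // x y xi; apply/lfunP => w.
- by rewrite DE !LE ppE !sp ssE; ring.
- by rewrite DE LE !QE LE SE ssE; ring.
- by rewrite DE !QE RE sp; ring.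
- by rewrite LE !SE ppE opprD.
- by rewrite LE !RE !LE ppE !sp ssE; ring.
- by rewrite RE !QE ssE opprD.
- by rewrite DE !SE LE sp; ring.
- by rewrite DE RE !SE QE RE ppE; ring.
- by rewrite DE !RE ppE !sp ssE; ring.
Qed.
End Coregular.

Section Sharp.
Variables (K : fieldType) (A : vectType K) (omega : {skew_symmetric A}).

Lemma skew_symmetricE x y : omega x y = - omega y x.
Proof. by rewrite hermC /= expr1 mulN1r. Qed.

Lemma sharp_bij : nondegenerate omega -> bijective (sharp omega).
Proof.
move=> /eqP nd.
(* The kernel of [sharp omega] lies in the radical of [omega]. *)
have ker0 : lker (sharp omega) == 0%VS.
  rewrite -subv0 -nd; apply/subvP => x; rewrite memv_ker => /eqP sx0.
  by apply/mem_orthovP => y _; rewrite -sharpE sx0 zero_lfunE.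
exists (sharp omega)^-1%VF; first exact: lker0_lfunK.
move=> xi; apply: limg_lfunVK.
suff -> : limg (sharp omega) = fullv by exact: memvf.
apply/eqP; rewrite eqEdim subvf limg_dim_eq; last by rewrite (eqP ker0) capv0.
by rewrite !dimvf /dim /= muln1.
Qed.
End Sharp.

Section Regular.
Variables (K : fieldType) (lambda : K) (A : vectType K).
Variables (prec succ : {bilinear A -> A -> A}) (P : 'End(A)).

Lemma rb_compatible_lmult (m : {bilinear A -> A -> A}) :
  is_rota_baxter lambda m P -> rb_compatible lambda P P (lmult m).
Proof. by move=> mP x u; rewrite !lmultE mP. Qed.

Lemma rb_compatible_rmult (m : {bilinear A -> A -> A}) :
  is_rota_baxter lambda m P -> rb_compatible lambda P P (rmult m).
Proof. by move=> mP x u; rewrite !rmultE mP [m (P u) x + _]addrC. Qed.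

(** Compatibility is linear in the action; this carries it from the single multiplications to their
    sums, whose duals occur in the coregular data. *)
Lemma rb_compatibleD (V : vectType K) (T : 'End(V))
    (F G : 'Hom(A, 'End(V))) :
    rb_compatible lambda P T F -> rb_compatible lambda P T G ->
  rb_compatible lambda P T (F + G).
Proof.
move=> FP GP x u; rewrite !add_lfunE FP GP -linearD scalerDr; congr (T _).
by rewrite addrACA; congr (_ + _); rewrite addrACA.
Qed.

(** With [A] as its own module, the nine identities are the three axioms, each read with one of its
    arguments as the module element. *)
Lemma regular_repP : is_rb_dendriform lambda prec succ P ->
  is_rb_rep lambda prec succ P (regular_rep prec succ P).
Proof.
case=> dA precP succP; have [pp sp ss] := dA.
rewrite /dendriform_mult in pp ss.
split=> /=; try by [exact: rb_compatible_lmult | exact: rb_compatible_rmult].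
apply: is_dendriform_rep_of => // x y u; rewrite !(lmultE, rmultE).
all: by rewrite ?(pp, sp, ss) ?(linearDl, linearDr).
Qed.

Lemma coregular_repP : is_rb_dendriform lambda prec succ P ->
  is_rb_rep lambda prec succ P (coregular_rep lambda prec succ P).
Proof.
case=> dA precP succP; split=> /=.
- exact: dendriform_rep_coregular.
- apply: rb_compatible_dual; apply: rb_compatibleD; exact: rb_compatible_rmult.
- apply/rb_compatible_opp/rb_compatible_dual; exact: rb_compatible_lmult.
- apply/rb_compatible_opp/rb_compatible_dual; exact: rb_compatible_rmult.
- apply: rb_compatible_dual; apply: rb_compatibleD; exact: rb_compatible_lmult.
Qed.

Lemma sharp_regular_coregular (omega : {skew_symmetric A}) :
    is_quadratic_rb_dendriform lambda prec succ P omega ->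
  is_rb_rep_iso lambda prec succ P
    (regular_rep prec succ P) (coregular_rep lambda prec succ P) (sharp omega).
Proof.
case=> hA nd sp sm wP; split; last exact: sharp_bij.
(* Skew-symmetry turns the first invariance relation into a rule for [prec] in the left slot, needed
   for the two [prec] actions. *)
have ps x y z : omega (prec x y) z = omega (succ z x) y.
  by rewrite skew_symmetricE sp.
split=> /=; [exact: regular_repP | exact: coregular_repP | | move=> x..].
all: apply/lfunP => y; apply/lfunP => z; rewrite 2!comp_lfunE sharpE.
(* Moved to one side, the intertwining of the operators is the relation between [omega] and [P]. *)
- apply/eqP; rewrite coregular_opE !sharpE -opprD -addr_eq0 addrA.
  by rewrite -addrA [_ + omega _ _]addrC addrA wP.
- by rewrite dual_actE !add_lfunE sharpE lmultE !rmultE sm.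
- by rewrite !opp_lfunE dual_actE sharpE lmultE rmultE sp.
- by rewrite !opp_lfunE dual_actE sharpE lmultE rmultE ps skew_symmetricE.
- by rewrite dual_actE !add_lfunE sharpE rmultE !lmultE ps sm.
Qed.
End Regular.

Theorem theorem4p16 (K : fieldType) (lambda : K) (A : vectType K)
    (prec succ : {bilinear A -> A -> A}) (P : 'End(A))
    (hA : is_rb_dendriform lambda prec succ P) :
  is_rb_rep lambda prec succ P (coregular_rep lambda prec succ P) /\
  (forall omega : {skew_symmetric A},
     is_quadratic_rb_dendriform lambda prec succ P omega ->
     is_rb_rep_iso lambda prec succ P
       (regular_rep prec succ P) (coregular_rep lambda prec succ P)
       (sharp omega)).
Proof.
split; first exact: coregular_repP.
by move=> omega; apply: sharp_regular_coregular.
Qed.
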